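(* Let $\Omega\subset\mathbb{R}^N$ be a domain, let $k:\Omega\times\Omega\to\mathbb{R}$ be a continuous, strictly positive definite kernel with reproducing kernel Hilbert space $\mathcal{H}_k(\Omega)$, and let $(A(\Omega),B(\Omega))$ be a $k$-admissible pair of Banach spaces of functions on $\Omega$. Let $(X_n)_{n\in\mathbb{N}}$ be a nested sequence of finite sets of pairwise distinct points $X_n\subset\Omega$ with dense union, i.e. $X_1\subset X_2\subset\cdots$ and $\overline{\bigcup_{n\in\mathbb{N}}X_n}=\overline{\Omega}$. For each $n$ let $\Pi^n_{A,B}:A(\Omega)\to B(\Omega)$, $\Pi^n_{A,B}f=\sum_{x\in X_n}f(x)\,l_x$, be the (bounded linear) kernel interpolation operator, where $\{l_x\}_{x\in X_n}$ is the Lagrange basis associated with $k$ and $X_n$. Then $$\lim_{n\to\infty}\|f-\Pi^n_{A,B}f\|_{B(\Omega)}=0\quad\text{for all } f\in A(\Omega)$$ if and only if the sequence of operator norms $\bigl(\|\Pi^n_{A,B}\|_{\mathcal{L}(A(\Omega),B(\Omega))}\bigr)_{n\in\mathbb{N}}$ is bounded uniformly in $n$.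
   Context: A kernel is a symmetric function $k:\Omega\times\Omega\to\mathbb{R}$; it is strictly positive definite if for every finite set of pairwise distinct points $x_1,\dots,x_n\in\Omega$ the matrix $(k(x_i,x_j))_{i,j}$ is positive definite. $\mathcal{H}_k(\Omega)$ denotes the unique reproducing kernel Hilbert space of real-valued functions on $\Omega$ with reproducing kernel $k$. Lagrange basis: for a finite set $X\subset\Omega$ of pairwise distinct points, $V(X)=\mathrm{span}\{k(x,\cdot):x\in X\}\subset\mathcal{H}_k(\Omega)$, and $\{l_x\}_{x\in X}\subset V(X)$ is the unique family with $l_x(y)=\delta_{xy}$ for all $x,y\in X$ (the family depends on $X$). $k$-admissible pair: two Banach spaces $A(\Omega),B(\Omega)$ of functions on $\Omega$ form a $k$-admissible pair on $\Omega$ if (a) there is $c_A>0$ with $|f(x)|\le c_A\|f\|_{A(\Omega)}$ for all $f\in A(\Omega)$, $x\in\Omega$; (b) $\mathcal{H}_k(\Omega)\hookrightarrow A(\Omega)$ continuously: there is $C_A>0$ with $\|f\|_{A(\Omega)}\le C_A\|f\|_{\mathcal{H}_k(\Omega)}$ for all $f\in\mathcal{H}_k(\Omega)$; (c) $\mathcal{H}_k(\Omega)$ is dense in $A(\Omega)$ with respect to $\|\cdot\|_{A(\Omega)}$; (d) $A(\Omega)\hookrightarrow B(\Omega)$ continuously: there is $C_B>0$ with $\|f\|_{B(\Omega)}\le C_B\|f\|_{A(\Omega)}$ for all $f\in A(\Omega)$. (For spaces such as $L^2(\Omega)$, functions are identified up to almost everywhere equality, as usual.) *)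

(* Defs.v *)
From HB Require Import structures.
From mathcomp Require Import all_boot all_order all_algebra.
From mathcomp Require Import finmap sesquilinear.
From mathcomp Require Import all_classical all_reals all_analysis.
Import Order.TTheory GRing.Theory Num.Theory.
Import numFieldNormedType.Exports.

Set Implicit Arguments.
Unset Strict Implicit.
Unset Printing Implicit Defensive.

Local Open Scope classical_set_scope.
Local Open Scope ring_scope.

Definition is_domain (R : realType) (N : nat) (Omega : set 'rV[R]_N) : Prop :=
  [/\ open Omega, connected Omega & Omega !=set0].

(* MathComp-Analysis has no Lebesgue measure on R^N; only its null sets are
   needed, and these are the sets with coverings by countably many boxes
   [a i, b i] of arbitrarily small total volume. *)
Definition lebesgue_null (R : realType) (N : nat) (E : set 'rV[R]_N) : Prop :=
  forall eps : R, 0 < eps ->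
    exists a b : nat -> 'rV[R]_N,
      [/\ forall i j, a i ord0 j <= b i ord0 j,
          E `<=` \bigcup_i [set x | forall j, a i ord0 j <= x ord0 j <= b i ord0 j]
        & (\sum_(0 <= i <oo) (\prod_(j < N) (b i ord0 j - a i ord0 j))%:E
             <= eps%:E)%E].

(* When two functions on Omega are regarded as the same: always if they are
   equal, or as soon as they agree almost everywhere (as for L^2(Omega)). *)
Variant identification := Pointwise | AlmostEverywhere.

Definition same_function (R : realType) (N : nat) (Omega : set 'rV[R]_N)
    (m : identification) (f g : Omega -> R) : Prop :=
  match m with
  | Pointwise => f = g
  | AlmostEverywhere => lebesgue_null (set_val @` [set x : Omega | f x <> g x])
  end.

(* A Banach space of functions on Omega: an abstract Banach space, each element
   u of which is given as a function [fs_fun u], or as the class of [fs_fun u]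
   modulo almost everywhere equality. *)
Record function_space (R : realType) (N : nat) (Omega : set 'rV[R]_N)
    (m : identification) := FunctionSpace {
  fs_car :> completeNormedModType R;
  fs_fun : fs_car -> Omega -> R;
  fs_funP : forall (a : R) (u v : fs_car),
    same_function m (fs_fun (a *: u + v)) (fun x => a * fs_fun u x + fs_fun v x);
  fs_fun_inj : forall u v : fs_car,
    same_function m (fs_fun u) (fs_fun v) -> u = v }.

Definition represents (R : realType) (N : nat) (Omega : set 'rV[R]_N)
    (m : identification) (S : function_space Omega m) (g : Omega -> R) (u : S) :
    Prop :=
  same_function m (fs_fun u) g.

(* The element of S given by the function g (unique by [fs_fun_inj]); it is
   meaningful only if g belongs to S, and 0 by convention otherwise. *)
Definition element (R : realType) (N : nat) (Omega : set 'rV[R]_N)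
    (m : identification) (S : function_space Omega m) (g : Omega -> R) : S :=
  xget 0 [set u : S | represents g u].

Definition embeds (R : realType) (N : nat) (Omega : set 'rV[R]_N)
    (m1 m2 : identification)
    (S1 : function_space Omega m1) (S2 : function_space Omega m2) : Prop :=
  exists2 C : R, 0 < C &
    forall u : S1, exists2 v : S2, represents (fs_fun u) v & `|v| <= C * `|u|.

Definition is_kernel (R : realType) (T : Type) (k : T -> T -> R) : Prop :=
  forall x y, k x y = k y x.

Definition positive_definite_mx (R : realType) (n : nat) (M : 'M[R]_n) : Prop :=
  forall c : 'rV[R]_n, c != 0 -> 0 < (c *m M *m c^T) ord0 ord0.

Definition strictly_positive_definite (R : realType) (T : Type)
    (k : T -> T -> R) : Prop :=
  forall (n : nat) (x : 'I_n -> T), injective x ->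
    positive_definite_mx (\matrix_(i, j) k (x i) (x j)).

(* {dot H for idfun} is the type of symmetric, bilinear, positive definite
   forms on H. *)
Record rkhs (R : realType) (N : nat) (Omega : set 'rV[R]_N)
    (k : Omega -> Omega -> R) := RKHS {
  rkhs_space :> function_space Omega Pointwise;
  rkhs_dot : {dot rkhs_space for idfun}%R;
  rkhs_normE : forall h : rkhs_space, `|h| = Num.sqrt (rkhs_dot h h);
  rkhs_reproducing : forall x : Omega,
    exists2 kx : rkhs_space, fs_fun kx = k x &
      forall h : rkhs_space, rkhs_dot h kx = fs_fun h x }.

(* V(X) = span {k(x, .) : x in X}, as a set of functions. *)
Definition kernel_span (R : realType) (N : nat) (Omega : set 'rV[R]_N)
    (k : Omega -> Omega -> R) (X : {fset Omega}) : set (Omega -> R) :=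
  [set g | exists c : Omega -> R, g = fun y => \sum_(x <- X) c x * k x y].

(* The values of l outside X are irrelevant. *)
Definition lagrange_basis (R : realType) (N : nat) (Omega : set 'rV[R]_N)
    (k : Omega -> Omega -> R) (X : {fset Omega}) (l : Omega -> Omega -> R) :
    Prop :=
  forall x, x \in X ->
    kernel_span k X (l x) /\ (forall y, y \in X -> l x y = (x == y)%:R).

(* Point values of elements of A are meaningful because of the identification
   [Pointwise]. *)
Record admissible_pair (R : realType) (N : nat) (Omega : set 'rV[R]_N)
    (k : Omega -> Omega -> R) (H : rkhs k) (m : identification)
    (A : function_space Omega Pointwise) (B : function_space Omega m) : Prop := {
  adm_eval : exists2 c : R, 0 < c &
    forall (f : A) (x : Omega), `|fs_fun f x| <= c * `|f|;
  adm_rkhs : embeds H A;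
  adm_dense : dense [set f : A | exists h : H, represents (fs_fun h) f];
  adm_embeds : embeds A B }.

Definition interpolation (R : realType) (N : nat) (Omega : set 'rV[R]_N)
    (m : identification)
    (A : function_space Omega Pointwise) (B : function_space Omega m)
    (X : {fset Omega}) (l : Omega -> Omega -> R) (f : A) : B :=
  element B (fun y => \sum_(x <- X) fs_fun f x * l x y).

Definition operator_norm (R : realType) (V W : normedModType R) (T : V -> W) :
    \bar R :=
  ereal_sup [set (`|T f|)%:E | f in [set f : V | `|f| <= 1]].

(* Main.v *)
Require Import Defs.
From mathcomp Require Import all_boot all_order all_algebra.
From mathcomp Require Import finmap sesquilinear lra.
From mathcomp Require Import all_classical all_reals all_analysis.
Import Order.TTheory GRing.Theory Num.Theory.
Import numFieldNormedType.Exports.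

Set Implicit Arguments.
Unset Strict Implicit.
Unset Printing Implicit Defensive.

Local Open Scope classical_set_scope.
Local Open Scope ring_scope.

(* The interpolant s_n in H of h in H agrees with h on X_n, so by the
   reproducing property h - s_n is orthogonal to V(X_n), and s_m - s_n is
   orthogonal to s_n for n <= m. Hence |s_n| is nondecreasing and bounded by |h|,
   s_n is Cauchy by Pythagoras, and its limit, being continuous and equal to h on
   a dense set, is h. So the interpolation operators converge on the image of H,
   which is dense in A; a uniform bound carries the convergence to all of A, and
   Banach-Steinhaus gives the converse. *)

(** * Null sets *)

Lemma lebesgue_null_sub (R : realType) (N : nat) (E F : set 'rV[R]_N) :
  E `<=` F -> lebesgue_null F -> lebesgue_null E.
Proof.
move=> EF nF eps /nF[a [b [ab cover vol]]].
by exists a, b; split=> //; exact: subset_trans cover.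
Qed.

(** The first [n.*2] interleaved terms are exactly the first [n] terms of both series, and with
    nonnegative terms every partial sum lies below one of this kind. *)
Lemma nneseries_interleave_le (R : realType) (u v : nat -> \bar R) :
  (forall i, 0 <= u i)%E -> (forall i, 0 <= v i)%E ->
  (\sum_(0 <= i <oo) (if odd i then v i./2 else u i./2)
    <= \sum_(0 <= i <oo) u i + \sum_(0 <= i <oo) v i)%E.
Proof.
move=> u0 v0; pose w i := if odd i then v i./2 else u i./2.
have w0 i : (0 <= w i)%E by rewrite /w; case: (odd i).
rewrite -[leLHS]/(\sum_(0 <= i <oo) w i)%E.
apply: lime_le; first by apply: is_cvg_nneseries => i _ _; exact: w0.
apply: nearW => n.
have -> : (\sum_(0 <= i <oo) u i + \sum_(0 <= i <oo) v i
    = \sum_(0 <= i <oo) (u i + v i))%E by rewrite nneseriesD.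
apply: le_trans (nneseries_lim_ge n _); last by move=> *; rewrite adde_ge0.
apply: (@le_trans _ _ (\sum_(0 <= i < n.*2) w i)%E).
  by apply: lee_sum_nneg_natr => //; rewrite -addnn leq_addr.
elim: n => [|n IH]; first by rewrite !big_geq.
rewrite doubleS !big_nat_recr//= -addeA leeD// /w /= odd_double /=.
by rewrite doubleK uphalf_double.
Qed.

(** Coverings of volume at most [eps / 2] are interleaved: even indices cover [E], odd ones [F]. *)
Lemma lebesgue_nullU (R : realType) (N : nat) (E F : set 'rV[R]_N) :
  lebesgue_null E -> lebesgue_null F -> lebesgue_null (E `|` F).
Proof.
move=> nE nF eps eps_gt0; have eps2 : 0 < eps / 2 by rewrite divr_gt0.
have [a [b [ab Eab vol_ab]]] := nE _ eps2.
have [c [d [cd Fcd vol_cd]]] := nF _ eps2.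
exists (fun i => if odd i then c i./2 else a i./2),
  (fun i => if odd i then d i./2 else b i./2); split.
- by move=> i j; case: ifP.
- move=> x [/Eab|/Fcd] [i _ xi].
    by exists i.*2 => //=; rewrite odd_double doubleK.
  by exists i.*2.+1 => //=; rewrite odd_double /= uphalf_double.
- pose u i := (\prod_(j < N) (b i ord0 j - a i ord0 j))%:E.
  pose v i := (\prod_(j < N) (d i ord0 j - c i ord0 j))%:E.
  rewrite (splitr eps) EFinD; apply: le_trans (leeD vol_ab vol_cd).
  rewrite (@eq_eseriesr _ _ (fun i => if odd i then v i./2 else u i./2)).
    by apply: nneseries_interleave_le => i; rewrite lee_fin prodr_ge0// => j _;
      rewrite subr_ge0.
  by move=> i _; case: (odd i).
Qed.

(** * Identification of functions and uniqueness of representatives *)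

Section same_function.
Context (R : realType) (N : nat) (Omega : set 'rV[R]_N) (m : identification).
Implicit Types f g h : Omega -> R.

Lemma same_function_sym f g : same_function m f g -> same_function m g f.
Proof.
case: m => //= nfg; apply: (lebesgue_null_sub _ nfg).
by apply: image_subset => x /= gf /esym.
Qed.

(** The two combinations can differ only where [f], [f'] or [g], [g'] differ, a union of two null
    sets. *)
Lemma same_function_op2 (F : R -> R -> R) f f' g g' :
  same_function m f f' -> same_function m g g' ->
  same_function m (fun x => F (f x) (g x)) (fun x => F (f' x) (g' x)).
Proof.
case: m => /= [-> -> //|nf ng].
apply: (lebesgue_null_sub _ (lebesgue_nullU nf ng)) => _ [x /= neq <-].
have [eqf|] := pselect (f x = f' x); last by left; exists x.
by right; exists x => // eqg; apply: neq; rewrite eqf eqg.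
Qed.

Lemma same_function_trans f g h :
  same_function m f g -> same_function m g h -> same_function m f h.
Proof.
case: m => /= [-> //|nfg ngh].
apply: (lebesgue_null_sub _ (lebesgue_nullU nfg ngh)) => _ [x /= neq <-].
have [eqf|] := pselect (f x = g x); last by left; exists x.
by right; exists x => // eqg; apply: neq; rewrite eqf eqg.
Qed.

Lemma elementE (S : function_space Omega m) g (u : S) :
  represents g u -> element S g = u.
Proof.
move=> gu; apply: xget_subset1 => //= v w gv gw; apply: fs_fun_inj.
exact: same_function_trans (same_function_sym gw).
Qed.

End same_function.

(** * Linearity of point values *)

Section pointwise_space.
Context (R : realType) (N : nat) (Omega : set 'rV[R]_N).
Context (S : function_space Omega Pointwise).

Lemma fs_funPE a (u v : S) x : fs_fun (a *: u + v) x = a * fs_fun u x + fs_fun v x.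
Proof. by rewrite (fs_funP a u v). Qed.

Lemma fs_fun0 x : fs_fun (0 : S) x = 0.
Proof. by have := fs_funPE (-1) (0 : S) 0 x; rewrite scaler0 addr0 mulN1r addNr. Qed.

Lemma fs_funZ a (u : S) x : fs_fun (a *: u) x = a * fs_fun u x.
Proof. by rewrite -[a *: u]addr0 fs_funPE fs_fun0 addr0. Qed.

Lemma fs_funD (u v : S) x : fs_fun (u + v) x = fs_fun u x + fs_fun v x.
Proof. by rewrite -[u]scale1r fs_funPE scale1r mul1r. Qed.

Lemma fs_funB (u v : S) x : fs_fun (u - v) x = fs_fun u x - fs_fun v x.
Proof. by rewrite fs_funD -scaleN1r fs_funZ mulN1r. Qed.

Lemma fs_fun_sum (I : Type) (r : seq I) (F : I -> S) x :
  fs_fun (\sum_(i <- r) F i) x = \sum_(i <- r) fs_fun (F i) x.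
Proof.
elim: r => [|i r IH]; first by rewrite !big_nil fs_fun0.
by rewrite !big_cons fs_funD IH.
Qed.

End pointwise_space.

(** * Inclusions between function spaces *)

Section embedding.
Context (R : realType) (N : nat) (Omega : set 'rV[R]_N) (m : identification).
Context (S1 : function_space Omega Pointwise) (S2 : function_space Omega m).

(** The inclusion as a total map; under [embeds] a representative always exists, so the default
    value of [element] never intervenes. *)
Definition embedding (u : S1) : S2 := element S2 (fs_fun u).

Context (S12 : embeds S1 S2).

Lemma embedding_represents (u : S1) : represents (fs_fun u) (embedding u).
Proof. by have [C _ /(_ u)[v uv _]] := S12; rewrite /embedding (elementE uv). Qed.

Lemma embedding_linear : linear embedding.
Proof.
move=> a u v; apply: elementE.
apply: (same_function_trans (fs_funP _ _ _)).
rewrite (fs_funP a u v).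
exact: (same_function_op2 (fun s t => a * s + t) (embedding_represents u)
  (embedding_represents v)).
Qed.

Lemma embedding_bounded :
  exists2 C, 0 < C & forall u : S1, `|embedding u| <= C * `|u|.
Proof.
have [C C_gt0 SC] := S12; exists C => // u.
by have [v uv vu] := SC u; rewrite /embedding (elementE uv).
Qed.

End embedding.

(** * Real inner products *)

Section dot_product.
Context (R : realFieldType) (U : lmodType R) (dot : {dot U for (@idfun R)}).
Implicit Types u v w : U.

Lemma dotC u v : dot u v = dot v u.
Proof. by rewrite hermitian_subproof mul1r. Qed.

Lemma dot_ge0 u : 0 <= dot u u.
Proof.
by have [->|u0] := eqVneq u 0; [rewrite linear0l|rewrite ltW// neq0_dnorm_gt0].
Qed.

Lemma dotZr a u v : dot u (a *: v) = a * dot u v.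
Proof. by rewrite linearZr_LR. Qed.

Lemma dotZl a u v : dot (a *: u) v = a * dot u v.
Proof. by rewrite dotC dotZr dotC. Qed.

Lemma dot_sumr (I : Type) (r : seq I) (F : I -> U) u :
  dot u (\sum_(i <- r) F i) = \sum_(i <- r) dot u (F i).
Proof. exact: linear_sumr. Qed.

Lemma dotBr u v w : dot u (v - w) = dot u v - dot u w.
Proof. exact: linearBr. Qed.

Lemma dotBl u v w : dot (u - v) w = dot u w - dot v w.
Proof. exact: linearBl. Qed.

Lemma dot_Cauchy_Schwarz u v : dot u v ^+ 2 <= dot u u * dot v v.
Proof.
have [->|v0] := eqVneq v 0; first by rewrite !linear0r expr0n.
have vv : 0 < dot v v by rewrite neq0_dnorm_gt0.
(* The square of this vector expands to [dot v v] times the difference of the two sides of the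
   claim. *)
have := dot_ge0 (dot v v *: u - dot u v *: v).
rewrite dotBl !dotBr !dotZl !dotZr (dotC v u) => h.
rewrite -subr_ge0 -(pmulr_rge0 _ vv); apply: le_trans h _; lra.
Qed.

End dot_product.

(** * Evaluation and interpolation in the RKHS *)

Section rkhs_theory.
Context (R : realType) (N : nat) (Omega : set 'rV[R]_N).
Context (k : Omega -> Omega -> R) (H : rkhs k).
Implicit Types (h u v : H) (x y : Omega) (X : {fset Omega}).

Local Notation dot := (rkhs_dot H).

Lemma rkhs_normE2 h : `|h| ^+ 2 = dot h h.
Proof. by rewrite rkhs_normE sqr_sqrtr ?dot_ge0. Qed.

(** The Riesz representer of evaluation at [x]. *)
Definition kernel_section x : H := sval (cid2 (rkhs_reproducing H x)).

Lemma fs_fun_kernel_section x : fs_fun (kernel_section x) = k x.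
Proof. by rewrite /kernel_section; case: cid2. Qed.

Lemma dot_kernel_section h x : dot h (kernel_section x) = fs_fun h x.
Proof. by rewrite /kernel_section; case: cid2. Qed.

Lemma rkhs_eval_le h x : `|fs_fun h x| <= `|h| * Num.sqrt (k x x).
Proof.
rewrite -dot_kernel_section rkhs_normE -sqrtrM ?dot_ge0// -sqrtr_sqr ler_wsqrtr//.
by rewrite -(fs_fun_kernel_section x) -dot_kernel_section dot_Cauchy_Schwarz.
Qed.

Lemma rkhs_eval_sub_le h x y :
  (fs_fun h x - fs_fun h y) ^+ 2 <= `|h| ^+ 2 * (k x x - k y x - (k x y - k y y)).
Proof.
rewrite -!dot_kernel_section -dotBr rkhs_normE2.
apply: le_trans (dot_Cauchy_Schwarz _ _ _) _; rewrite le_eqVlt; apply/orP; left.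
apply/eqP; congr (_ * _).
by rewrite dotBr !dot_kernel_section !fs_funB !fs_fun_kernel_section.
Qed.

(** By the reproducing property, vanishing on [X] means being orthogonal to all kernel sections at
    points of [X], hence to their span. *)
Lemma kernel_span_rkhs X (g : Omega -> R) : kernel_span k X g ->
  exists2 u : H, fs_fun u = g &
    forall v, (forall x, x \in X -> fs_fun v x = 0) -> dot v u = 0.
Proof.
move=> [c ->]; exists (\sum_(x <- X) c x *: kernel_section x).
  apply/funext => y; rewrite fs_fun_sum; apply: eq_bigr => x _.
  by rewrite fs_funZ fs_fun_kernel_section.
move=> v vX; rewrite dot_sumr big_seq big1// => x xX.
by rewrite dotZr dot_kernel_section vX ?mulr0.
Qed.

Context (X : {fset Omega}) (l : Omega -> Omega -> R).
Context (lX : lagrange_basis k X l).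

(** The data [c] is any function, so that values of elements of [H] and of [A] can both be
    interpolated inside [H]. *)
Definition rkhs_interpolant (c : Omega -> R) : H :=
  \sum_(x <- X) c x *: element H (l x).

Lemma lagrange_represents x : x \in X -> represents (l x) (element H (l x)).
Proof.
move=> /lX[/kernel_span_rkhs[u ul _] _].
by rewrite (elementE (ul : represents (l x) u)).
Qed.

Lemma fs_fun_rkhs_interpolant (c : Omega -> R) :
  fs_fun (rkhs_interpolant c) = fun y => \sum_(x <- X) c x * l x y.
Proof.
apply/funext => y; rewrite fs_fun_sum big_seq [RHS]big_seq.
by apply: eq_bigr => x /lagrange_represents lx; rewrite fs_funZ lx.
Qed.

Lemma rkhs_interpolant_node (c : Omega -> R) y : y \in X ->
  fs_fun (rkhs_interpolant c) y = c y.
Proof.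
move=> yX; rewrite fs_fun_rkhs_interpolant (bigD1_seq y)//= ?fset_uniq//.
have [_ ->//] := lX yX; rewrite eqxx mulr1 big_seq_cond big1 ?addr0//.
by move=> x /andP[/lX[_ ->//] xy]; rewrite (negPf xy) mulr0.
Qed.

Lemma dot_rkhs_interpolant v (c : Omega -> R) :
  (forall x, x \in X -> fs_fun v x = 0) -> dot v (rkhs_interpolant c) = 0.
Proof.
move=> vX; rewrite dot_sumr big_seq big1// => x xX; rewrite dotZr.
have [/kernel_span_rkhs[u ul vu] _] := lX xX.
by rewrite (elementE (ul : represents (l x) u)) vu ?mulr0.
Qed.

End rkhs_theory.

(** * Density, and continuity of RKHS functions *)

Lemma dense_subtype (T : topologicalType) (A : set T) (D : set A) :
  A `<=` closure (set_val @` D) -> dense D.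
Proof.
(* Open sets of the subtype are traces of open sets [V] of [T]. *)
move=> AD U [x Ux] [V oV VU].
have xV : V (set_val x) by move: Ux; rewrite -VU.
have [_ [[y Dy <-] Vy]] := AD _ (set_valP x) V (open_nbhs_nbhs (conj oV xV)).
by exists y; split=> //; rewrite -VU.
Qed.

Lemma eq0_on_dense (R : realType) (T : topologicalType) (D : set T) (f : T -> R) :
  dense D -> continuous f -> {in D, forall x, f x = 0} -> forall x, f x = 0.
Proof.
move=> dD cf f0 x; apply/eqP/negP => /negP fx0.
have oU : open (f @^-1` [set~ 0]).
  by apply: open_comp => [y _|]; [exact: cf|apply: closed_openC; exact: closed_eq].
have [y [+ Dy]] : (f @^-1` [set~ 0] `&` D) !=set0.
  by apply: dD => //; exists x; apply/eqP.
by apply; apply: f0; rewrite inE.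
Qed.

(* For a function in an RKHS the hypothesis is Cauchy-Schwarz: the factor of c is
   the squared distance of the kernel sections at x and y. *)
Lemma continuous_kernel_bounded (R : realType) (T : topologicalType)
    (k : T -> T -> R) (c : R) (f : T -> R) :
  continuous (fun p : T * T => k p.1 p.2) ->
  (forall x y, (f x - f y) ^+ 2 <= c * (k x x - k y x - (k x y - k y y))) ->
  continuous f.
Proof.
move=> k_cont f_le x.
have kyx : k y x @[y --> x] --> k x x.
  by apply: (cvg_comp _ _ (cvg_pair cvg_id (cvg_cst x)) (k_cont (x, x))).
have kxy : k x y @[y --> x] --> k x x.
  by apply: (cvg_comp _ _ (cvg_pair (cvg_cst x) cvg_id) (k_cont (x, x))).
have kyy : k y y @[y --> x] --> k x x.
  by apply: (cvg_comp _ _ (cvg_pair cvg_id cvg_id) (k_cont (x, x))).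
have : c * (k x x - k y x - (k x y - k y y)) @[y --> x] -->
    c * (k x x - k x x - (k x x - k x x)).
  by apply: cvgMl_tmp; apply: cvgB; apply: cvgB => //; exact: cvg_cst.
rewrite !subrr mulr0 => d0; apply/cvgrPdist_lt => e e_gt0.
have e2 : 0 < e ^+ 2 by rewrite exprn_gt0.
near=> y; rewrite -ltr_sqr ?nnegrE// ?ltW// -normrX ger0_norm ?sqr_ge0//.
apply: le_lt_trans (f_le _ _) _; apply: le_lt_trans (ler_norm _) _.
by near: y; exact: (cvgr0_norm_lt _ d0).
Unshelve. all: by end_near. Qed.

Lemma rkhs_continuous (R : realType) (N : nat) (Omega : set 'rV[R]_N)
  (k : Omega -> Omega -> R) (H : rkhs k) (h : H) :
  continuous (fun p : Omega * Omega => k p.1 p.2) -> continuous (fs_fun h).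
Proof.
move=> k_cont; apply: (continuous_kernel_bounded k_cont).
exact: rkhs_eval_sub_le.
Qed.

(** * Convergence of the interpolants in the RKHS *)

Lemma orthogonal_increments_cvg (R : realType) (N : nat) (Omega : set 'rV[R]_N)
    (k : Omega -> Omega -> R) (H : rkhs k) (s : nat -> H) (C : R) :
  (forall n m, (n <= m)%N -> rkhs_dot H (s m - s n) (s n) = 0) ->
  (forall n, rkhs_dot H (s n) (s n) <= C) -> cvg (s @ \oo).
Proof.
move=> orth bound; pose q n := rkhs_dot H (s n) (s n).
(* Pythagoras: orthogonality makes the mixed product of [s m] and [s n] equal to [q n]. *)
have qE n m : (n <= m)%N -> `|s m - s n| ^+ 2 = q m - q n.
  move=> nm; have := orth _ _ nm; rewrite rkhs_normE2 dotBl => /subr0_eq smn.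
  by rewrite dotBr !dotBl [rkhs_dot H (s n) (s m)]dotC smn subrr subr0.
have qC : cvg (q @ \oo).
  apply: nondecreasing_is_cvgn => [n m nm|].
    by rewrite -subr_ge0 -qE// sqr_ge0.
  by exists C => _ [n _ <-]; exact: bound.
have qle n : q n <= limn q.
  apply: nondecreasing_cvgn_le => // i j ij.
  by rewrite -subr_ge0 -qE// sqr_ge0.
apply/cauchy_cvgP/cauchy_exP => e e_gt0.
have e2 : 0 < e ^+ 2 by rewrite exprn_gt0.
have /cvgrPdist_lt /(_ _ e2) [n _ qn] := qC.
exists (s n); exists n => // m nm; rewrite -ball_normE /= distrC.
rewrite -ltr_sqr ?nnegrE// ?ltW// qE//.
(* The squared distance [q m - q n] is at most [limn q - q n], which is small by the choice of
   [n]. *)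
apply: le_lt_trans (qn n (leqnn n)).
by rewrite ger0_norm ?subr_ge0// lerB.
Qed.

Section interpolation_limit.
Context (R : realType) (N : nat) (Omega : set 'rV[R]_N).
Context (k : Omega -> Omega -> R) (H : rkhs k).
Context (k_continuous : continuous (fun p : Omega * Omega => k p.1 p.2)).
Context (X : nat -> {fset Omega}) (X_nested : forall n, (X n `<=` X n.+1)%fset).
Context (X_dense : dense (\bigcup_n [set` X n])).
Context (l : nat -> Omega -> Omega -> R).
Context (l_lagrange : forall n, lagrange_basis k (X n) (l n)).

Lemma nested_le n m : (n <= m)%N -> (X n `<=` X m)%fset.
Proof.
move=> /subnKC <-; elim: (m - n)%N => [|d IH]; first by rewrite addn0 fsubset_refl.
by rewrite addnS (fsubset_trans IH).
Qed.

Lemma rkhs_interpolant_cvg (h : H) :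
  rkhs_interpolant H (X n) (l n) (fs_fun h) @[n --> \oo] --> h.
Proof.
set s := fun n => _.
have s_node n y : y \in X n -> fs_fun (s n) y = fs_fun h y.
  by move=> yX; rewrite /s rkhs_interpolant_node.
have orth n m : (n <= m)%N -> rkhs_dot H (s m - s n) (s n) = 0.
  move=> nm; apply: dot_rkhs_interpolant => // y yX.
  by rewrite fs_funB !s_node ?subrr// (fsubsetP (nested_le nm)).
have bound n : rkhs_dot H (s n) (s n) <= rkhs_dot H h h.
  have hs : rkhs_dot H (h - s n) (s n) = 0.
    by apply: dot_rkhs_interpolant => // y yX; rewrite fs_funB s_node ?subrr.
  (* As [h - s n] is orthogonal to [s n], its squared norm is that of [h] minus that of [s n]. *)
  have := dot_ge0 (rkhs_dot H) (h - s n).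
  move: hs; rewrite !dotBr !dotBl => /subr0_eq hs.
  by rewrite [rkhs_dot H (s n) h]dotC hs subrr subr0 subr_ge0.
have s_cvg := orthogonal_increments_cvg orth bound.
suff -> : h = lim (s @ \oo) by [].
set h' := lim _ in s_cvg *.
apply: fs_fun_inj; apply/funext => x; apply/eqP; rewrite -subr_eq0 -fs_funB.
apply/eqP; apply: (eq0_on_dense X_dense (rkhs_continuous k_continuous)) x => x.
rewrite inE => -[n _ /= xX].
(* Norm convergence in [H] implies pointwise convergence; adding 1 in [c] ensures a positive
   divisor. *)
have sx : fs_fun (s n) x @[n --> \oo] --> fs_fun h' x.
  apply/cvgrPdist_lt => e e_gt0.
  pose c := Num.sqrt (k x x) + 1; have c_gt0 : 0 < c by rewrite ltr_wpDl// sqrtr_ge0.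
  near=> m; rewrite -fs_funB; apply: le_lt_trans (rkhs_eval_le _ _) _.
  apply: (@le_lt_trans _ _ (`|h' - s m| * c)).
    by rewrite ler_wpM2l// lerDl.
  rewrite -ltr_pdivlMr//; near: m.
  by move/cvgrPdist_lt: s_cvg; apply; rewrite divr_gt0.
rewrite fs_funB; apply/eqP; rewrite subr_eq0; apply/eqP.
(* Since [x] lies in some [X n], nestedness makes these values equal to [fs_fun h x] from that index
   on. *)
suff hx : fs_fun (s n) x @[n --> \oo] --> fs_fun h x.
  exact: (cvg_unique _ hx sx).
apply: cvg_near_cst; exists n => // m /= nm.
by rewrite s_node// (fsubsetP (nested_le nm)).
Unshelve. all: by end_near. Qed.

End interpolation_limit.

(** * The interpolation operator from [A] to [B] *)

Section interpolation_operator.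
Context (R : realType) (N : nat) (Omega : set 'rV[R]_N).
Context (k : Omega -> Omega -> R) (H : rkhs k) (m : identification).
Context (A : function_space Omega Pointwise) (B : function_space Omega m).
Context (AB : admissible_pair H A B).
Context (X : {fset Omega}) (l : Omega -> Omega -> R).
Context (lX : lagrange_basis k X l).

Local Notation iota := (@embedding _ _ _ m A B).
Local Notation J := (@embedding _ _ _ Pointwise H A).

(** Factoring through [H] shows that the sum really belongs to [B] and lets linearity and
    boundedness be inherited from the two inclusions. *)
Lemma interpolationE (f : A) :
  interpolation B X l f = iota (J (rkhs_interpolant H X l (fs_fun f))).
Proof.
apply: elementE; rewrite -(fs_fun_rkhs_interpolant H lX).
have <- : fs_fun (J (rkhs_interpolant H X l (fs_fun f))) =
    fs_fun (rkhs_interpolant H X l (fs_fun f)).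
  exact: embedding_represents (adm_rkhs AB) _.
exact: embedding_represents (adm_embeds AB) _.
Qed.

Lemma interpolation_linear : linear (interpolation B X l : A -> B).
Proof.
move=> a f g; rewrite !interpolationE -(embedding_linear (adm_embeds AB)).
rewrite -(embedding_linear (adm_rkhs AB)); congr (iota (J _)).
rewrite /rkhs_interpolant scaler_sumr -big_split; apply: eq_bigr => x _ /=.
by rewrite fs_funPE scalerDl scalerA.
Qed.

Lemma interpolation_bounded :
  exists C, forall f : A, `|interpolation B X l f : B| <= C * `|f|.
Proof.
have [c c_gt0 evalA] := adm_eval AB.
have [CA CA_gt0 HA] := embedding_bounded (adm_rkhs AB).
have [CB CB_gt0 AB'] := embedding_bounded (adm_embeds AB).
(* Each coefficient [fs_fun f x] is at most [c] times the norm of [f]; [CA] and [CB] pay for the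
   inclusions of [H] in [A] and of [A] in [B]. *)
exists (CB * (CA * (\sum_(x <- X) c * `|element H (l x)|))) => f.
rewrite interpolationE -!mulrA.
apply: le_trans (AB' _) _; rewrite ler_pM2l//.
apply: le_trans (HA _) _; rewrite ler_pM2l// mulr_suml.
apply: le_trans (ler_norm_sum _ _ _) _; apply: ler_sum => x _.
by rewrite normrZ mulrAC ler_wpM2r.
Qed.

End interpolation_operator.

(** * Operator norms and the equivalence *)

Lemma operator_norm_le (R : realType) (V W : normedModType R) (T : V -> W) (M : R) :
  linear T -> (operator_norm T <= M%:E)%E -> forall f, `|T f| <= M * `|f|.
Proof.
move=> linT TM f.
have TZ a u : T (a *: u) = a *: T u by exact: scalable_linear.
have [->|f0] := eqVneq f 0.
  by have := TZ 0 0; rewrite !scale0r => ->; rewrite !normr0 mulr0.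
have nf : 0 < `|f| by rewrite normr_gt0.
(* Dividing by the norm of [f] moves the claim to a unit vector, where the supremum applies. *)
rewrite -ler_pdivrMr// mulrC -[X in X * _]ger0_norm ?invr_ge0// -normrZ -TZ.
rewrite -lee_fin; apply: le_trans TM; apply: ereal_sup_ubound.
by exists (`|f|^-1 *: f) => //=; rewrite normrZ normfV normr_id mulVf ?gt_eqF.
Qed.

Theorem theorem3p2 (R : realType) (N : nat) (N_gt0 : (0 < N)%N)
    (Omega : set 'rV[R]_N) (Omega_domain : is_domain Omega)
    (k : Omega -> Omega -> R)
    (k_kernel : is_kernel k)
    (k_continuous : continuous (fun p : Omega * Omega => k p.1 p.2))
    (k_spd : strictly_positive_definite k)
    (H : rkhs k)
    (m : identification)
    (A : function_space Omega Pointwise) (B : function_space Omega m)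
    (AB_admissible : admissible_pair H A B)
    (X : nat -> {fset Omega})
    (X_nested : forall n, (X n `<=` X n.+1)%fset)
    (X_dense : closure (\bigcup_n (set_val @` [set` X n])) = closure Omega)
    (l : nat -> Omega -> Omega -> R)
    (l_lagrange : forall n, lagrange_basis k (X n) (l n)) :
  (forall f : A,
      (fun n => `|element B (fs_fun f) - interpolation B (X n) (l n) f|)
        @ \oo --> (0 : R))
  <->
  (exists M : R, forall n,
      (operator_norm (interpolation B (X n) (l n) : A -> B) <= M%:E)%E).
Proof.
have D_dense : dense (\bigcup_n [set` X n]).
  apply: dense_subtype; rewrite image_bigcup X_dense; exact: subset_closure.
have lin n := interpolation_linear AB_admissible (l_lagrange n).
have linI := embedding_linear (adm_embeds AB_admissible).
split=> [cvgf|[M opM] f].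
  pose F := range (fun n => (interpolation B (X n) (l n) : A -> B)).
  have FM : uniform_bounded F.
    apply: Banach_Steinhauss.
    - move=> _ [n _ <-]; split; last exact: lin.
      have [C CP] := interpolation_bounded AB_admissible (l_lagrange n).
      move=> r; exists (`|C| * r) => f fr; apply: le_trans (CP f) _.
      by apply: (@le_trans _ _ (`|C| * `|f|)); rewrite ?ler_wpM2r ?ler_wpM2l ?ler_norm.
    - move=> f.
      (* Pointwise boundedness: the errors converge, hence are bounded, and the interpolant is [f]
         minus its error. *)
      have /cvgP/cvg_seq_bounded[M [_ MP]] := cvgf f.
      exists (`|element B (fs_fun f)| + (M + 1)) => _ [n _ <-].
      rewrite -(subKr (element B (fs_fun f)) (interpolation _ _ _ _)).
      apply: le_trans (ler_normB _ _) _; rewrite lerD2l.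
      have M1 : M < M + 1 by rewrite ltrDl.
      by have := MP _ M1 n I; rewrite /= normr_id.
  (* The uniform bound on the ball of radius 1 bounds every operator norm. *)
  have [K KP] := FM 1; exists K => n; apply: ge_ereal_sup => _ [f /= f1 <-].
  by rewrite lee_fin; apply: KP => //; exists n.
have [C C_gt0 CP] := embedding_bounded (adm_embeds AB_admissible).
have [CA CA_gt0 CAP] := embedding_bounded (adm_rkhs AB_admissible).
apply/cvgr0Pnorm_lt => e e_gt0; have e2_gt0 : 0 < e / 2 by rewrite divr_gt0.
have K_gt0 : 0 < C + `|M| + 1 by rewrite ltr_wpDl// addr_ge0// ltW.
(* Inclusion and interpolation together enlarge norms by at most [C + |M|], so an error [d] in [A]
   costs at most [e / 2] in [B]; the 1 keeps the divisor positive. *)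
pose d := e / 2 / (C + `|M| + 1); have d_gt0 : 0 < d by rewrite divr_gt0.
have [g [fg [h gh]]] : (ball f d
    `&` [set f : A | exists h : H, represents (fs_fun h) f]) !=set0.
  by apply: (adm_dense AB_admissible); [exists f; exact: ballxx|exact: ball_open].
have linIB := zmod_morphism_linear linI.
have linJB := zmod_morphism_linear (embedding_linear (adm_rkhs AB_admissible)).
have opP n (u : A) : `|interpolation B (X n) (l n) u : B| <= `|M| * `|u|.
  apply: (le_trans (operator_norm_le (lin n) (opM n) u)).
  by rewrite ler_wpM2r// ler_norm.
have hcvg := rkhs_interpolant_cvg k_continuous X_nested D_dense l_lagrange (h := h).
near=> n.
set P := interpolation B (X n) (l n).
rewrite normr_id -[f in element B (fs_fun f)](subrK g) -[f in P f](subrK g).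
(* By linearity the error of [f] splits into that of [f - g], controlled by [d] uniformly in [n],
   and that of [g]. *)
have -> : element B (fs_fun (f - g + g)) - P (f - g + g) =
    embedding B (f - g) - P (f - g) + (embedding B g - P g).
  rewrite -/(embedding B (f - g + g)) -[P (f - g)]scale1r.
  by rewrite -[embedding B (f - g)]scale1r addrACA -opprD -linI -lin scale1r.
(* As [g] is the image of [h], its error is the image of the interpolation error of [h] in [H]. *)
have -> : embedding B g - P g =
    embedding B (embedding A (h - rkhs_interpolant H (X n) (l n) (fs_fun h))).
  rewrite /P (interpolationE AB_admissible (l_lagrange n)) -linIB.
  rewrite [embedding A (h - _)]linJB (elementE gh : embedding A h = g).
  by have -> : fs_fun g = fs_fun h by [].
rewrite (splitr e); apply: le_lt_trans (ler_normD _ _) _; apply: ler_ltD.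
  apply: le_trans (ler_normB _ _) _.
  apply: le_trans (lerD (CP _) (opP _ _)) _; rewrite -mulrDl.
  have fgd : `|f - g| <= d by move: fg; rewrite -ball_normE => /ltW.
  apply: (@le_trans _ _ ((C + `|M| + 1) * d)).
    by rewrite ler_pM ?lerDl ?addr_ge0// ltW.
  by rewrite /d mulrC divfK// gt_eqF.
(* Dividing out both inclusion constants leaves a distance in [H] to be made less than
   [e / 2 / C / CA], which holds for large [n]. *)
apply: le_lt_trans (CP _) _; rewrite mulrC -ltr_pdivlMr//.
apply: le_lt_trans (CAP _) _; rewrite mulrC -ltr_pdivlMr//.
by near: n; move/cvgrPdist_lt: hcvg; apply; rewrite !divr_gt0.
Unshelve. all: by end_near. Qed.
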